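(* Let $(X_i,Y_i)_{i\ge1}$ be i.i.d. pairs with values in $\mathcal X\times\mathbb R$ with the law of $(X,Y)$. Let $V:\mathcal X\times\mathbb R\to\mathbb R$ be one of the following non-conformity scores: (i) $V(x,y)=|y-f(x)|$; (ii) $V(x,y)=|y-f(x)|/\sigma(x)$; (iii) $V(x,y)=\max\{\hat f_{\alpha_{\mathrm{lo}}}(x)-y,\ y-\hat f_{\alpha_{\mathrm{hi}}}(x)\}$, where $f,\hat f_{\alpha_{\mathrm{lo}}},\hat f_{\alpha_{\mathrm{hi}}}:\mathcal X\to\mathbb R$ and $\sigma:\mathcal X\to(0,\infty)$ are fixed functions. Let $x\in\mathcal X$. Suppose that the conditional density estimator is consistent, i.e. the estimates $P_{\phi}(Y\mid X=x)=P_{\phi_n}(Y\mid X=x)$ of the conditional law $P(Y\mid X=x)$ satisfy $$\lim_{n\to\infty}\mathrm{KS}\big(P(Y\mid X=x),P_{\phi_n}(Y\mid X=x)\big)=0,$$ and that the regularization $\mathrm{KS}\big(P_{\phi_n}(V\mid X=x),P(V)\big)$ is reduced to be below $\epsilon$ by optimization. Then, for every $\alpha\in[0,1]$, with $C_n$ the split conformal prediction set at miscoverage level $\alpha$ built from the calibration data $(X_i,Y_i)_{i=1}^n$, $$1-\alpha-\epsilon\ \le\ \mathbb P\big(Y_{n+1}\in C_n(X_{n+1})\mid X_{n+1}=x\big)\ \le\ 1-\alpha+\epsilon\qquad\text{as } n\to\infty .$$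
   Context: For two probability distributions $P,Q$ on $\mathbb R$ with CDFs $F_P,F_Q$, the Kolmogorov–Smirnov distance is $\mathrm{KS}(P,Q)=\sup_{t\in\mathbb R}|F_P(t)-F_Q(t)|$. $P(V)$ is the marginal law of $V(X,Y)$; $P(Y\mid X=x)$ is the conditional law of $Y$ given $X=x$; $P_{\phi_n}(V\mid X=x)$ is the law of $V(x,\hat Y)$ with $\hat Y\sim P_{\phi_n}(Y\mid X=x)$. The estimates $P_{\phi_n}$ are obtained from training data separate from the calibration data. Conditioning on $X_{n+1}=x$ means that $Y_{n+1}$ is drawn from $P(Y\mid X=x)$ independently of $(X_i,Y_i)_{i=1}^n$. ''As $n\to\infty$'' means that the inequalities hold for the limit of the conditional coverage probability. Split conformal prediction: the threshold $q^*_n$ is the $\lceil (n+1)(1-\alpha)\rceil/n$ empirical quantile of the calibration scores $V(X_1,Y_1),\dots,V(X_n,Y_n)$, i.e. the $\lceil (n+1)(1-\alpha)\rceil$-th smallest of them, with $q^*_n=+\infty$ if $\lceil (n+1)(1-\alpha)\rceil>n$ and $q^*_n=-\infty$ if it is $0$; the prediction set is $C_n(x)=\{y\in\mathbb R: V(x,y)\le q^*_n\}$.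
   Formalization: The upper bound is stated under the added assumption that P(V) has no atoms (automatic when Y has conditional densities); without it the claim fails, e.g. Y = f(X), V = |y−f(x)|, ε < α < 1, where coverage tends to 1. *)

(* Defs.v *)
From mathcomp Require Import all_boot all_order all_algebra finmap.
From mathcomp Require Import all_classical all_reals all_analysis.

Set Implicit Arguments.
Unset Strict Implicit.
Unset Printing Implicit Defensive.

Import Order.TTheory GRing.Theory Num.Theory.
Import numFieldNormedType.Exports.

Local Open Scope classical_set_scope.
Local Open Scope ring_scope.

(* Kolmogorov-Smirnov distance.  The arguments are bare set functions so that
   KS applies directly to [pushforward], whose measure structure requires a
   proof of measurability. *)
Definition KS (R : realType) (mu nu : set R -> \bar R) : R :=
  sup [set `|fine (mu `]-oo, t]%classic) -
             fine (nu `]-oo, t]%classic)| | t in [set: R]].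

Definition mutually_independent d d' (T : measurableType d)
    (T' : measurableType d') (R : realType) (P : probability T R)
    (Z : nat -> T -> T') : Prop :=
  forall (I : {fset nat}) (B : nat -> set T'),
    (forall i, i \in I -> measurable (B i)) ->
    P (\bigcap_(i in [set` I]) Z i @^-1` B i) =
    (\prod_(i <- I) P (Z i @^-1` B i))%E.

Definition iid_with_law d d' (T : measurableType d) (T' : measurableType d')
    (R : realType) (P : probability T R) (Z : nat -> T -> T')
    (Q : probability T' R) : Prop :=
  (forall i B, measurable B -> P (Z i @^-1` B) = Q B) /\
  mutually_independent P Z.

(* [kappa] is a version of the conditional law of the second component given
   the first one, under the joint law [Q]. *)
Definition conditional_law d (X : measurableType d) (R : realType)
    (Q : probability (X * R)%type R) (kappa : R.-pker X ~> R) : Prop :=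
  forall (A : set X) (B : set R), measurable A -> measurable B ->
    Q (A `*` B) = (\int[pushforward Q fst]_(x in A) kappa x B)%E.

Inductive nonconformity_score d (X : measurableType d) (R : realType) :
    (X -> R -> R) -> Prop :=
| AbsoluteResidual (f : X -> R) of measurable_fun [set: X] f :
    nonconformity_score (fun x y => `|y - f x|)
| ScaledResidual (f sigma : X -> R) of measurable_fun [set: X] f
    & measurable_fun [set: X] sigma & (forall x, 0 < sigma x) :
    nonconformity_score (fun x y => `|y - f x| / sigma x)
| QuantileScore (f_lo f_hi : X -> R) of measurable_fun [set: X] f_lo
    & measurable_fun [set: X] f_hi :
    nonconformity_score (fun x y => Num.max (f_lo x - y) (y - f_hi x)).

(* [`| _ |] is harmless for [alpha <= 1], where the ceiling is nonnegative. *)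
Definition conformal_rank (R : realType) (alpha : R) (n : nat) : nat :=
  `|Num.ceil (n.+1%:R * (1 - alpha))|%N.

Definition conformal_threshold (R : realType) (alpha : R) (scores : seq R) :
    \bar R :=
  let k := conformal_rank alpha (size scores) in
  if k == 0%N then -oo%E
  else if (size scores < k)%N then +oo%E
  else (nth 0 (sort <=%R scores) k.-1)%:E.

Definition conformal_set (X : Type) (R : realType) (V : X -> R -> R)
    (alpha : R) (calibration : seq (X * R)) (x : X) : set R :=
  [set y | ((V x y)%:E <=
            conformal_threshold alpha [seq V z.1 z.2 | z <- calibration])%E].

(* Indices start at 0: the calibration data are the pairs number
   [0, ..., n - 1]. *)
Definition calibration_data (Omega X R : Type) (Xs : nat -> Omega -> X)
    (Ys : nat -> Omega -> R) (n : nat) (w : Omega) : seq (X * R) :=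
  [seq (Xs i w, Ys i w) | i <- iota 0 n].

(* Under [P \x kappa x] the test response is drawn from [kappa x],
   independently of the calibration data. *)
Definition conditional_coverage d d' (Omega : measurableType d)
    (X : measurableType d') (R : realType) (P : probability Omega R)
    (Xs : nat -> Omega -> X) (Ys : nat -> Omega -> R) (kappa : R.-pker X ~> R)
    (V : X -> R -> R) (alpha : R) (x : X) (n : nat) : \bar R :=
  (P \x kappa x)%E
    [set wy | conformal_set V alpha (calibration_data Xs Ys n wy.1) x wy.2].

(* Main.v *)
(* Since [t <= q*_n] holds iff fewer than [ceil ((n+1)(1-alpha))] of the
   calibration scores are [< t], the weak law of large numbers (Chebyshev's
   inequality for pairwise independent indicators) makes [P (t <= q*_n)] tend
   to 1 when [P(V < t) < 1 - alpha] and to 0 when [P(V < t) > 1 - alpha].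
   Write [H] for the CDF of [V(x, Y)] given [X = x] and [G] for that of [V].
   For every [t],
     [P (t <= q*_n) * H t <= coverage_n <= P (t <= q*_n) + H t],
   and [t] is taken to be a quantile of [P(V)] at a level slightly below
   (resp. above) [1 - alpha]; in the upper bound the absence of atoms gives
   [G t = P(V < t)].  Finally [|H t - G t| <= eps]: each score has closed
   intervals as sublevel sets in [y], on which two laws differ by at most twice
   their KS distance, which vanishes in the limit. *)
Require Import Defs.
From HB Require Import structures.
From mathcomp Require Import all_boot all_order all_algebra finmap.
From mathcomp Require Import all_classical all_reals all_analysis.
From mathcomp Require Import measurable_realfun ring lra.

Set Implicit Arguments.
Unset Strict Implicit.
Unset Printing Implicit Defensive.

Import Order.TTheory GRing.Theory Num.Theory.
Import numFieldNormedType.Exports.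

Local Open Scope classical_set_scope.
Local Open Scope ring_scope.

(** * Weak law of large numbers for pairwise independent events of equal probability *)

Section indicator_sum.
Context d (T : measurableType d) (R : realType) (P : probability T R).
Variables (A : nat -> set T) (r : R).
Hypothesis mA : forall i, measurable (A i).
Hypothesis PA : forall i, P (A i) = r%:E.
Hypothesis PAA : forall i j, i != j -> P (A i `&` A j) = (r * r)%:E.

Definition indicator_sum n : T -> R := \sum_(i < n) \1_(A i).

Lemma indicator_sum0 : indicator_sum 0 = cst 0.
Proof. by rewrite /indicator_sum big_ord0. Qed.

Lemma indicator_sumS n : indicator_sum n.+1 = indicator_sum n \+ \1_(A n).
Proof. by rewrite /indicator_sum big_ord_recr. Qed.

Lemma indic_Lfun2 (B : set T) : measurable B -> (\1_B : T -> R) \in Lfun P 2%:E.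
Proof.
move=> mB; rewrite inE/=; apply/andP; split; rewrite inE//=.
rewrite /finite_norm unlock poweR_lty//.
rewrite (eq_integral (fun w => (\1_B w)%:E)); last first.
  move=> w _ /=; rewrite indicE.
  by case: (_ \in _); rewrite /= ?normr1 ?powR1// normr0 powR0.
rewrite integral_indic// setIT.
by rewrite (le_lt_trans (probability_le1 _ _)) ?ltry.
Qed.

Lemma indicator_sum_Lfun2 n : indicator_sum n \in Lfun P 2%:E.
Proof.
elim: n => [|n IHn]; first by rewrite indicator_sum0 Lfun_cst.
rewrite indicator_sumS rpredD ?lee1n ?indic_Lfun2// => ?; exact: indic_Lfun2.
Qed.

Lemma expectation_indicator_sum n : ('E_P[indicator_sum n] = (n%:R * r)%:E)%E.
Proof.
have Pfin : P setT \is a fin_num := fin_num_measure P _ measurableT.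
elim: n => [|n IHn]; first by rewrite indicator_sum0 mul0r expectation_cst.
rewrite indicator_sumS expectationD.
- by rewrite expectation_indic// PA IHn -natr1 mulrDl mul1r EFinD.
- exact: Lfun_subset12 (indicator_sum_Lfun2 n).
- exact: Lfun_subset12 (indic_Lfun2 (mA n)).
Qed.

Lemma covariance_indic i j : i != j ->
  covariance P (\1_(A i)) (\1_(A j)) = 0%E.
Proof.
have Pfin : P setT \is a fin_num := fin_num_measure P _ measurableT.
move=> ij; have L1 k := Lfun_subset12 Pfin (indic_Lfun2 (mA k)).
have AAE : (\1_(A i) * \1_(A j) = \1_(A i `&` A j) :> (T -> R))%R.
  by rewrite indicI.
rewrite covarianceE//; last first.
  rewrite AAE; apply: Lfun_subset12 => //; apply: indic_Lfun2.
  exact: measurableI.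
by rewrite AAE !expectation_indic ?PA ?PAA//; [rewrite subee|exact: measurableI].
Qed.

(** [m <= n] keeps the index [n] apart from all the summed ones, so only vanishing covariances
    occur; this is what makes the variance additive. *)
Lemma covariance_indicator_sum m n : (m <= n)%N ->
  covariance P (indicator_sum m) (\1_(A n)) = 0%E.
Proof.
elim: m => [|m IHm] mn; first by rewrite indicator_sum0 covariance_cst_l.
rewrite indicator_sumS covarianceDl.
- by rewrite IHm ?(ltnW mn)// covariance_indic ?adde0// ltn_eqF.
- exact: indicator_sum_Lfun2.
- exact: indic_Lfun2.
- exact: indic_Lfun2.
Qed.

(** Each indicator contributes [r - r ^ 2 <= 1]. Linear growth suffices against deviations
    proportional to [n]. *)
Lemma variance_indicator_sum n : ('V_P[indicator_sum n] <= n%:R%:E)%E.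
Proof.
have Pfin : P setT \is a fin_num := fin_num_measure P _ measurableT.
elim: n => [|n IHn]; first by rewrite indicator_sum0 variance_cst.
rewrite indicator_sumS varianceD; last 2 first.
- exact: indicator_sum_Lfun2.
- exact: indic_Lfun2.
rewrite covariance_indicator_sum// mule0 adde0 -natr1 EFinD.
apply: leeD => //; rewrite varianceE; last exact: indic_Lfun2.
have -> : (\1_(A n) ^+ 2 = \1_(A n) :> (T -> R))%R.
  apply/funext => w; rewrite !fctE indicE expr2.
  by case: (_ \in _); rewrite ?mulr1 ?mulr0.
rewrite expectation_indic// PA -EFin_expe -EFinB lee_fin.
have : ((P (A n)) <= 1)%E by exact: probability_le1.
rewrite PA lee_fin; nra.
Qed.

Lemma indicator_sum_deviation n e : 0 < e ->
  (P [set w | (e <= `|indicator_sum n w - n%:R * r|)%R] <= (e ^- 2 * n%:R)%:E)%E.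
Proof.
move=> e0; have sM := sub_Lfun_mfun (indicator_sum_Lfun2 n).
have := @chebyshev _ _ _ P (mfun_Sub sM) _ e0.
rewrite mfun_valP expectation_indicator_sum/= => /le_trans; apply.
by rewrite EFinM lee_wpmul2l ?variance_indicator_sum// lee_fin invr_ge0 sqr_ge0.
Qed.

Lemma measurable_indicator_sum n : measurable_fun setT (indicator_sum n).
Proof. exact: set_mem (sub_Lfun_mfun (indicator_sum_Lfun2 n)). Qed.

Lemma measurable_indicator_sum_deviation n e :
  measurable [set w | e <= `|indicator_sum n w - n%:R * r|].
Proof.
rewrite -[X in measurable X]setTI.
suff mD : measurable_fun setT (fun w => e <= `|indicator_sum n w - n%:R * r|).
  exact: (mD measurableT [set true]).
apply: measurable_fun_ler => //; apply: measurableT_comp => //.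
by apply: measurable_funB => //; exact: measurable_indicator_sum.
Qed.

Lemma weak_lln_indicator_sum (delta e : R) : 0 < delta -> 0 < e ->
  \forall n \near \oo,
    (P [set w | (n%:R * delta <= `|indicator_sum n w - n%:R * r|)%R] <= e%:E)%E.
Proof.
move=> d0 e0; near=> n.
have n0 : 0 < n%:R :> R by near: n; exact: nbhs_infty_gtr.
(* Chebyshev at deviation [n * delta] gives [n / (n * delta) ^ 2], which is of order [1 / n]. *)
apply: le_trans (indicator_sum_deviation n (mulr_gt0 n0 d0)) _.
rewrite lee_fin (_ : _ * _ = delta ^- 2 / n%:R); last first.
  by field; rewrite !gt_eqF.
rewrite ler_pdivrMr// -ler_pdivrMl//.
near: n; exact: nbhs_infty_ger.
Unshelve. all: by end_near. Qed.

End indicator_sum.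

Arguments indicator_sum {d T R} A n _.

(** * Kolmogorov-Smirnov distance and closed intervals *)

Section kolmogorov_smirnov.
Context {R : realType}.

(** A real [sup] dominates its set only if the set is bounded; values in [[0, 1]] provide the bound
    1. *)
Lemma ge_KS (mu nu : set R -> \bar R) (t : R) :
  (forall s, (0 <= mu `]-oo, s]%classic <= 1)%E) ->
  (forall s, (0 <= nu `]-oo, s]%classic <= 1)%E) ->
  `|fine (mu `]-oo, t]%classic) - fine (nu `]-oo, t]%classic)| <= KS mu nu.
Proof.
move=> mu01 nu01; apply: ub_le_sup; last by exists t.
have fine01 (x : \bar R) : (0 <= x <= 1)%E -> 0 <= fine x <= 1.
  case: x => [x| |] => [|/andP[]|/andP[]]; rewrite ?lee_fin ?leye_eq ?leeNy_eq//=.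
exists 1 => _ [s _ <-].
have /fine01 := mu01 s; have /fine01 := nu01 s.
move=> /andP[? ?] /andP[? ?]; rewrite ler_norml; apply/andP; split; lra.
Qed.

Lemma itvNyo_bigcup (a : R) :
  `]-oo, a[%classic = \bigcup_n `]-oo, a - n.+1%:R^-1]%classic.
Proof.
apply/seteqP; split=> [y|y [n _]] /=; rewrite !in_itv/=.
  by move=> /ltr_add_invr[n yna]; exists n => //=; rewrite in_itv/= lerBrDr ltW.
by move=> /le_lt_trans; apply; rewrite ltrBlDr ltrDl invr_gt0.
Qed.

Lemma cvg_probability_itvNyo (P : probability R R) (a : R) :
  P `]-oo, a - n.+1%:R^-1]%classic @[n --> \oo] --> P `]-oo, a[%classic.
Proof.
rewrite itvNyo_bigcup.
apply: (@nondecreasing_cvg_mu _ _ _ P (fun n => `]-oo, a - n.+1%:R^-1]%classic)).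
- by move=> n; exact: measurable_itv.
- by apply: bigcup_measurable => n _; exact: measurable_itv.
- move=> m n mn; apply/subsetPset/subset_itvl; rewrite bnd_simp lerD2l lerN2.
  by rewrite lef_pV2 ?posrE// ler_nat.
Qed.

Variables mu nu : probability R R.

Lemma ge_KS_probability (t : R) :
  `|fine (mu `]-oo, t]%classic) - fine (nu `]-oo, t]%classic)| <= KS mu nu.
Proof. by apply: ge_KS => s; rewrite measure_ge0 probability_le1. Qed.

(** The bound at [a - 1 / (n + 1)] passes to the limit by continuity from below. *)
Lemma ge_KS_itvNyo (a : R) :
  `|fine (mu `]-oo, a[%classic) - fine (nu `]-oo, a[%classic)| <= KS mu nu.
Proof.
have cvg_fine (P : probability R R) : fine (P `]-oo, a - n.+1%:R^-1]%classic)
    @[n --> \oo] --> fine (P `]-oo, a[%classic).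
  apply: fine_cvg; rewrite fineK ?fin_num_measure//.
  exact: cvg_probability_itvNyo.
have mnu := cvgB (cvg_fine mu) (cvg_fine nu).
apply: (cvgr_to_le (cvg_norm (mnu _))).
by apply: nearW => n; exact: ge_KS_probability.
Qed.

(** The mass of [[a, b]] is the CDF at [b] minus its left limit at [a]; each term costs one KS
    distance. *)
Lemma ge_KS_itvcc (a b : R) :
  `|fine (mu `[a, b]%classic) - fine (nu `[a, b]%classic)| <= 2 * KS mu nu.
Proof.
have [ba|ab] := ltP b a.
  rewrite set_itv_ge ?bnd_simp -?ltNge// !measure0 subrr normr0.
  by rewrite mulr_ge0// (le_trans _ (ge_KS_probability 0)).
have itvE (P : probability R R) : fine (P `[a, b]%classic) =
    fine (P `]-oo, b]%classic) - fine (P `]-oo, a[%classic).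
  have -> : `]-oo, b]%classic = `]-oo, a[%classic `|` `[a, b]%classic.
    by rewrite -itv_bndbnd_setU// bnd_simp.
  rewrite measureU//; first by rewrite fineD ?fin_num_measure// addrAC subrr add0r.
  apply/seteqP; split=> // y /=; rewrite !in_itv/= => -[ya /andP[]].
  by rewrite leNgt ya.
rewrite !itvE; have := ge_KS_probability b; have := ge_KS_itvNyo a.
rewrite !ler_norml => /andP[? ?] /andP[? ?]; apply/andP; split; lra.
Qed.

End kolmogorov_smirnov.

(** * Sublevel sets of the scores, and the threshold as an order statistic *)

Section scores.
Context d (X : measurableType d) (R : realType).

(** Apart from measurability, this is all that is used of the shape of the three scores. The
    interval may be empty, for instance when a residual is compared with a negative [t]. *)
Lemma nonconformity_score_preimage (V : X -> R -> R) x t :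
  nonconformity_score V ->
  exists a b, V x @^-1` `]-oo, t]%classic = `[a, b]%classic.
Proof.
case=> [f _|f sigma _ _ s0|flo fhi _ _].
- exists (f x - t), (f x + t); apply/seteqP; split=> y /=;
    by rewrite !in_itv/= ler_distl.
- exists (f x - t * sigma x), (f x + t * sigma x); apply/seteqP; split=> y /=;
    by rewrite !in_itv/= ler_pdivrMr// ler_distl.
- exists (flo x - t), (fhi x + t); apply/seteqP; split=> y /=;
    rewrite !in_itv/= ge_max => /andP[? ?]; apply/andP; split; lra.
Qed.

Lemma measurable_nonconformity_score (V : X -> R -> R) :
  nonconformity_score V ->
  measurable_fun [set: X * R] (fun z => V z.1 z.2).
Proof.
have mfst (f : X -> R) : measurable_fun setT f ->
    measurable_fun [set: X * R] (f \o fst).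
  by move=> mf; exact: measurableT_comp.
have mres (f : X -> R) : measurable_fun setT f ->
    measurable_fun [set: X * R] (fun z => `|z.2 - f z.1|).
  move=> mf; apply: measurableT_comp => //.
  by apply: measurable_funB => //; exact: mfst.
case=> [f mf|f sigma mf ms s0|flo fhi mlo mhi]; first exact: mres.
- apply: measurable_funM; first exact: mres.
  (* Positivity of [sigma] turns the inverse into a real power, which is measurable. *)
  have -> : (fun z : X * R => (sigma z.1)^-1) =
      (fun z => (sigma z.1) `^ (- 1)).
    by apply/funext => z; rewrite powR_inv1// ltW.
  exact: (measurableT_comp (measurable_powR _) (mfst _ ms)).
- by apply: measurable_maxr; apply: measurable_funB => //; exact: mfst.
Qed.

(** The [k]-th smallest score is at least [t] exactly when fewer than [k] scores lie below [t]. The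
    infinite values agree: no count is below rank 0, and every count is below a rank exceeding the
    size. *)
Lemma le_conformal_threshold (alpha t : R) (s : seq R) :
  (t%:E <= conformal_threshold alpha s)%E =
  (count (< t) s < conformal_rank alpha (size s))%N.
Proof.
rewrite /conformal_threshold; case: conformal_rank => [|k] //=.
have [sk|ks] := ltnP.
  by rewrite leey (leq_ltn_trans (count_size _ _)).
have ss : sorted <=%R (sort <=%R s) by exact: sort_le_sorted.
rewrite lee_fin -(count_sort <=%R) ltnS.
apply/idP/idP => [|ck]; last by apply: nth_count_ge; rewrite // ck size_sort.
by apply: contraTT; rewrite -ltnNge -ltNge => kc; exact: nth_count_lt.
Qed.

End scores.

(** * Quantiles of a real random variable *)

Section quantile.
Context d (T : measurableType d) (R : realType) (P : probability T R).

(** The witness is the infimum of the points where the CDF reaches [p]. The limits of the CDF at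
    both infinities make that set nonempty and bounded below; points left of the infimum give the
    first inequality, right continuity the second. *)
Lemma exists_quantile (X : {RV P >-> R}) (p : R) : 0 < p < 1 ->
  exists t, (P (X @^-1` `]-oo, t[%classic) <= p%:E <=
             P (X @^-1` `]-oo, t]%classic))%E.
Proof.
move=> /andP[p0 p1]; pose S := [set t | (p%:E <= cdf X t)%E].
have S_neq0 : S !=set0.
  apply: contrapT => S0; suff : (1 <= p%:E)%E by rewrite lee_fin leNgt p1.
  apply: (cvge_to_le (cvg_cdfy1 X)); apply: nearW => t.
  by rewrite leNgt; apply/negP => /ltW St; apply: S0; exists t.
have S_lb : has_lbound S.
  have [t tS] : exists t, ~ S t.
    apply: contrapT => allS; suff : (p%:E <= 0)%E by rewrite lee_fin leNgt p0.
    apply: (cvge_to_ge (cvg_cdfNy0 X)); apply: nearW => t.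
    by apply: contrapT => St; apply: allS; exists t.
  exists t => s Ss; rewrite leNgt; apply/negP => st; apply: tS.
  by rewrite /S/= (le_trans Ss)// cdf_nondecreasing// ltW.
exists (inf S); apply/andP; split.
  apply: (cvge_to_le (@cvg_probability_itvNyo _ (distribution P X) (inf S))).
  apply: nearW => n; rewrite leNgt; apply/negP => /ltW Sn.
  have := ge_inf S_lb Sn; rewrite lerBrDr gerDl leNgt invr_gt0 ltr0n//.
rewrite -[leRHS]/(cdf X (inf S)).
have cvgS := @cdf_right_continuous _ _ _ _ X (inf S).
apply: (cvge_to_ge cvgS).
near=> t.
have [s Ss st] : exists2 s, S s & s < t.
  by apply: inf_lt => //; near: t; exact: nbhs_right_gt.
by rewrite (le_trans Ss)// cdf_nondecreasing// ltW.
Unshelve. all: by end_near. Qed.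

End quantile.

(** * Lower and upper limits from eventual bounds with slack, and rounding of the rank *)

Lemma limn_einf_ge (R : realType) (u : (\bar R)^nat) (c : R) :
  (forall e, 0 < e -> \forall n \near \oo, ((c - e)%:E <= u n)%E) ->
  (c%:E <= limn_einf u)%E.
Proof.
move=> uc; apply/lee_subgt0Pr => e e0; rewrite -EFinB limn_einf_lim.
apply: lime_ge; first exact: is_cvg_einfs.
have [N _ uN] := uc _ e0; exists N => // n /= Nn.
by apply: le_ereal_inf_tmp => _ [m /= nm <-]; apply: uN; exact: leq_trans nm.
Qed.

Lemma limn_esup_le (R : realType) (u : (\bar R)^nat) (c : R) :
  (forall e, 0 < e -> \forall n \near \oo, (u n <= (c + e)%:E)%E) ->
  (limn_esup u <= c%:E)%E.
Proof.
move=> uc; apply/lee_addgt0Pr => e e0; rewrite -EFinD limn_esup_lim.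
apply: lime_le; first exact: is_cvg_esups.
have [N _ uN] := uc _ e0; exists N => // n /= Nn.
by apply: ge_ereal_sup => _ [m /= nm <-]; apply: uN; exact: leq_trans nm.
Qed.

Lemma conformal_rank_itv (R : realType) (alpha : R) (n : nat) : alpha <= 1 ->
  n.+1%:R * (1 - alpha) <= (conformal_rank alpha n)%:R <
  n.+1%:R * (1 - alpha) + 1.
Proof.
move=> a1; have x0 : 0 <= n.+1%:R * (1 - alpha) by rewrite mulr_ge0// subr_ge0.
have -> : (conformal_rank alpha n)%:R = (Num.ceil (n.+1%:R * (1 - alpha)))%:~R :> R.
  by rewrite natr_absz ger0_norm// -(ler_int R) (le_trans x0)// ceil_ge.
by rewrite ceil_ge/= -ltrBlDr -[X in _ - X]/(1%:~R) -intrB ceilB1_lt.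
Qed.


(** Here [c] is a count, [k] the rank and [m] the sample size. The strict inequality between the
    integers absorbs the rounding up, and the extra [1 - alpha <= 1] from [m + 1] is paid by half
    the margin, as [1 <= m * delta / 2]. *)
Lemma count_below_rank_gap (R : realFieldType) (alpha r delta m c k : R) :
  0 <= alpha -> c + 1 <= k -> k < (m + 1) * (1 - alpha) + 1 ->
  2 <= m * delta -> m * (1 - alpha) <= m * (r - delta) ->
  m * (delta / 2) <= - (c - m * r).
Proof. lra. Qed.

(** * Concentration of the conformal threshold *)

Section threshold.
Context d (T : measurableType d) (R : realType) (P : probability T R).
Variables (S : nat -> T -> R) (alpha : R).
Hypothesis mS : forall i, measurable_fun setT (S i).

Let threshold n w := conformal_threshold alpha [seq S i w | i <- iota 0 n].

Let below t i := S i @^-1` `]-oo, t[%classic.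

Lemma measurable_below t i : measurable (below t i).
Proof. by rewrite -[X in measurable X]setTI; exact: mS. Qed.

Lemma indicator_sum_below t n w : indicator_sum (below t) n w =
  (count (< t) [seq S i w | i <- iota 0 n])%:R :> R.
Proof.
elim: n => [|n IHn]; first by rewrite indicator_sum0.
rewrite indicator_sumS -[in RHS]addn1 iotaD map_cat count_cat natrD -IHn/= addn0.
rewrite indicE (_ : (w \in _) = (S n w < t))//.
by apply/idP/idP; rewrite inE /below/= in_itv.
Qed.

Lemma threshold_preimage t n :
  [set w | (t%:E <= threshold n w)%E] =
  [set w | indicator_sum (below t) n w < (conformal_rank alpha n)%:R :> R].
Proof.
apply/seteqP; split=> w /=;
  by rewrite le_conformal_threshold indicator_sum_below ltr_nat size_map size_iota.
Qed.

Lemma measurable_threshold_preimage t n :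
  measurable [set w | (t%:E <= threshold n w)%E].
Proof.
rewrite threshold_preimage -[X in measurable X]setTI.
suff mk : measurable_fun setT (fun w =>
    indicator_sum (below t) n w < (conformal_rank alpha n)%:R :> R).
  exact: (mk measurableT [set true]).
apply: measurable_fun_ltr => //.
exact: (measurable_indicator_sum P (measurable_below t)).
Qed.

Lemma measurable_threshold n : measurable_fun setT (threshold n).
Proof.
(* Closed upper rays generate the Borel sets of the extended reals, and their preimages are the
   events above. *)
move=> mT; apply: (measurability _ (ErealGenCInfty.measurableE R)) => //.
move=> _ [_ [t ->] <-]; rewrite setTI.
rewrite (_ : _ @^-1` _ = [set w | (t%:E <= threshold n w)%E]).
  exact: measurable_threshold_preimage.
by apply/seteqP; split=> w /=; rewrite in_itv/= andbT.
Qed.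

Variables (t r delta e : R).
Hypothesis PS : forall i, P (below t i) = r%:E.
Hypothesis PSS : forall i j, i != j -> P (below t i `&` below t j) = (r * r)%:E.
Hypotheses (alpha_ge0 : 0 <= alpha) (alpha_le1 : alpha <= 1).
Hypotheses (delta0 : 0 < delta) (e0 : 0 < e).

(** If the threshold is below [t], then at least [(n + 1) * (1 - alpha) >= n * (r + delta)] scores
    are below [t], a deviation of at least [n * delta] above the mean. *)
Lemma near_le_threshold : r + delta <= 1 - alpha ->
  \forall n \near \oo,
    ((1 - e)%:E <= P [set w | (t%:E <= threshold n w)%E])%E.
Proof.
move=> rdelta.
have := weak_lln_indicator_sum (measurable_below t) PS PSS delta0 e0.
apply: filterS => n; set D := [set w | _] => PD.
have mA := measurable_threshold_preimage t n.
rewrite -[X in P X]setCK probability_setC; last exact: measurableC.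
rewrite EFinB leeB// (le_trans _ PD)// le_measure ?inE//.
- exact: measurableC.
- exact: (measurable_indicator_sum_deviation P _ (measurable_below t)).
have /andP[kge _] := conformal_rank_itv n alpha_le1.
rewrite threshold_preimage => w /= /negP; rewrite -leNgt => kw.
rewrite /D/= (le_trans _ (ler_norm _))// lerBrDl.
apply: (le_trans _ (le_trans kge kw)); rewrite -mulrDr -natr1 mulrDl mul1r.
by rewrite ler_wpDr ?subr_ge0// ler_wpM2l.
Qed.

Lemma near_threshold_le : 1 - alpha <= r - delta ->
  \forall n \near \oo,
    (P [set w | (t%:E <= threshold n w)%E] <= e%:E)%E.
Proof.
(* Rounding up and the factor [n + 1] now work against the bound, so half of [delta] is kept to
   absorb them once [n * delta >= 2]. *)
move=> rdelta; have delta2 : 0 < delta / 2 by rewrite divr_gt0.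
near=> n.
have : (P [set w | (n%:R * (delta / 2) <=
  `|indicator_sum (below t) n w - n%:R * r|)%R] <= e%:E)%E.
  near: n.
  exact: (weak_lln_indicator_sum (measurable_below t) PS PSS delta2 e0).
apply: le_trans; apply: le_measure; rewrite ?inE.
- exact: measurable_threshold_preimage.
- exact: (measurable_indicator_sum_deviation P _ (measurable_below t)).
rewrite threshold_preimage => w /=; rewrite indicator_sum_below ltr_nat.
have /andP[_ klt] := conformal_rank_itv n alpha_le1.
rewrite -(ler_nat R) -natr1 => kw.
have nd : 2 <= n%:R * delta.
  by rewrite -ler_pdivrMr//; near: n; exact: nbhs_infty_ger.
(* The count falls short of its mean, so the deviation is negative. *)
rewrite ler_normr; apply/orP; right.
have n0 : 0 <= n%:R :> R by [].
have h : n%:R * (1 - alpha) <= n%:R * (r - delta) by rewrite ler_wpM2l.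
rewrite -natr1 in klt.
exact: (count_below_rank_gap alpha_ge0 kw klt nd h).
Unshelve. all: by end_near. Qed.

End threshold.

(** * Coverage for a random threshold [q] and an independent response of law [K] *)

Section coverage.
Context d (T : measurableType d) (R : realType) (P : probability T R).
Variables (K : probability R R) (q : T -> \bar R) (v : R -> R).
Hypothesis mq : measurable_fun setT q.
Hypothesis mv : measurable_fun setT v.

Let covered : set (T * R) := [set wy | ((v wy.2)%:E <= q wy.1)%E].

Let measurable_covered : measurable covered.
Proof.
rewrite -[covered]setTI; apply: measurable_lee => //.
- by apply/measurable_EFinP; exact: measurableT_comp mv _.
- exact: measurableT_comp mq _.
Qed.

Let measurable_ge_threshold t : measurable [set w | (t%:E <= q w)%E].
Proof. by rewrite -[X in measurable X]setTI; apply: measurable_lee. Qed.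

Let measurable_le_score t : measurable (v @^-1` `]-oo, t]%classic).
Proof. by rewrite -[X in measurable X]setTI; exact: mv. Qed.

(** The covered event contains the rectangle where [t <= q] and [v <= t], whose product measure
    factorizes. *)
Lemma coverage_ge t :
  (P [set w | (t%:E <= q w)%E] * K (v @^-1` `]-oo, t]%classic) <=
   (P \x K) covered)%E.
Proof.
rewrite -product_measure1E//; apply: le_measure; rewrite ?inE//.
  exact: measurableX.
by move=> [w y] /= []; rewrite in_itv/= -lee_fin => tq vt; exact: le_trans vt tq.
Qed.

(** A covered point has either [v <= t] or [t < v <= q]; the union bound applies to the two
    corresponding strips. *)
Lemma coverage_le t :
  ((P \x K) covered <=
   P [set w | (t%:E <= q w)%E] + K (v @^-1` `]-oo, t]%classic))%E.
Proof.
pose A := [set w | (t%:E <= q w)%E]; pose B := v @^-1` `]-oo, t]%classic.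
have -> : P A = ((P \x K) (A `*` setT))%E.
  rewrite product_measure1E//; last exact: measurable_ge_threshold.
  by rewrite -[LHS]mule1; congr (_ * _)%E; apply/esym/probability_setT.
have -> : K B = ((P \x K) (setT `*` B))%E.
  rewrite product_measure1E//; last exact: measurable_le_score.
  by rewrite -[LHS]mul1e; congr (_ * _)%E; apply/esym/probability_setT.
have mA : measurable (A `*` [set: R]).
  by apply: measurableX => //; exact: measurable_ge_threshold.
have mB : measurable ([set: T] `*` B).
  by apply: measurableX => //; exact: measurable_le_score.
apply: le_trans (measureU2 _ mA mB); apply: le_measure; rewrite ?inE//.
  exact: measurableU.
move=> [w y] /= vq; rewrite /A/B/= in_itv/=.
have [vt|tv] := leP (v y) t; first by right.
by left; split=> //; rewrite (le_trans _ vq)// lee_fin ltW.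
Qed.

Lemma coverage_le1 : ((P \x K) covered <= 1)%E.
Proof.
have PK1 : ((P \x K) setT = 1)%E.
  rewrite -setXTT [LHS]product_measure1E// -[RHS]mule1.
  by congr (_ * _)%E; exact: probability_setT.
by rewrite -PK1; apply: le_measure; rewrite ?inE.
Qed.

End coverage.

(** * Pairwise independence and comparison of the score laws *)

Lemma mutually_independent_pair d d' (T : measurableType d)
    (T' : measurableType d') (R : realType) (P : probability T R)
    (Z : nat -> T -> T') (B : set T') i j :
  mutually_independent P Z -> measurable B -> i != j ->
  P (Z i @^-1` B `&` Z j @^-1` B) = (P (Z i @^-1` B) * P (Z j @^-1` B))%E.
Proof.
move=> PZ mB ij; have := PZ [fset i; j]%fset (fun=> B) (fun _ _ => mB).
rewrite big_fsetU1 ?inE// big_seq_fset1 => <-; congr (P _).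
apply/seteqP; split=> w.
  by move=> [wi wj] k /=; rewrite !inE => /orP[]/eqP->.
by move=> wB; split; apply: wB; rewrite /= !inE eqxx ?orbT.
Qed.

(** Triangle inequality through [phi n]: the first distance is at most twice a vanishing KS distance
    because the sublevel set is an interval, the second is at most [eps]. The left side does not
    depend on [n], so the limit leaves exactly [eps]. *)
Lemma KS_score_le d (X : measurableType d) (R : realType)
    (V : X -> R -> R) (x : X) (K : probability R R)
    (phi : nat -> probability R R) (G : set R -> \bar R) (eps : R) :
  nonconformity_score V -> measurable_fun setT (V x) ->
  (forall t, (0 <= G `]-oo, t]%classic <= 1)%E) ->
  KS K (phi n) @[n --> \oo] --> (0 : R) ->
  (\forall n \near \oo, KS (pushforward (phi n) (V x)) G <= eps) ->
  forall t, `|fine (K (V x @^-1` `]-oo, t]%classic)) -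
              fine (G `]-oo, t]%classic)| <= eps.
Proof.
move=> scoreV mVx G01 Kphi phiG t.
have -> : eps = 2 * 0 + eps by rewrite mulr0 add0r.
have cvg_eps : 2 * KS K (phi n) + eps @[n --> \oo] --> 2 * 0 + eps.
  by apply: cvgD; [apply: cvgMr|exact: cvg_cst].
apply: (cvgr_to_ge cvg_eps); apply: filterS phiG => n phiGn.
have [a [b VE]] := nonconformity_score_preimage x t scoreV.
have phi_bound : `|fine (pushforward (phi n) (V x) `]-oo, t]%classic) -
    fine (G `]-oo, t]%classic)| <= eps.
  apply: le_trans phiGn; apply: ge_KS => // s.
  have mI : measurable (V x @^-1` `]-oo, s]%classic).
    by rewrite -[X in measurable X]setTI; exact: mVx.
  apply/andP; split; first exact: measure_ge0.
  exact: (@probability_le1 _ _ _ (phi n) _ mI).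
have := ge_KS_itvcc K (phi n) a b; rewrite -VE => K_bound.
exact: le_trans (ler_distD _ _ _) (lerD K_bound phi_bound).
Qed.

Section kernel_probability.
Context d d' (X : measurableType d) (Y : measurableType d') (R : realType).
Variables (kappa : R.-pker X ~> Y) (x : X).

(** A named copy of [kappa x], to which the structure of a probability can be attached. *)
Definition kernel_probability : set Y -> \bar R := kappa x.

HB.instance Definition _ := Measure.on kernel_probability.

HB.instance Definition _ :=
  Measure_isProbability.Build _ _ _ kernel_probability (prob_kernel x).

End kernel_probability.

(** * Asymptotic conditional coverage *)

Theorem proposition5 (R : realType) (d d' : measure_display)
    (Omega : measurableType d) (X : measurableType d')
    (P : probability Omega R) (Q : probability (X * R)%type R)
    (Xs : nat -> {RV P >-> X}) (Ys : nat -> {RV P >-> R})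
    (iidXY : iid_with_law P (fun i w => (Xs i w, Ys i w)) Q)
    (kappa : R.-pker X ~> R) (kappaQ : conditional_law Q kappa)
    (V : X -> R -> R) (scoreV : nonconformity_score V)
    (x : X) (phi : nat -> X -> probability R R) (eps : R)
    (consistent : KS (kappa x) (phi n x) @[n --> \oo] --> (0 : R))
    (regularized : \forall n \near \oo,
      KS (pushforward (phi n x) (V x))
         (pushforward Q (fun z => V z.1 z.2)) <= eps)
    (alpha : R) (alpha_ge0 : 0 <= alpha) (alpha_le1 : alpha <= 1) :
  ((1 - alpha - eps)%:E <=
    limn_einf (conditional_coverage P Xs Ys kappa V alpha x))%E /\
  ((forall v : R, pushforward Q (fun z => V z.1 z.2) [set v] = 0%E) ->
   (limn_esup (conditional_coverage P Xs Ys kappa V alpha x) <=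
    (1 - alpha + eps)%:E)%E).
Proof.
have mV := measurable_nonconformity_score scoreV.
have mVx : measurable_fun setT (V x).
  exact: (measurableT_comp mV (pair1_measurable x)).
pose W : {RV Q >-> R} := mfun_Sub (mem_set mV).
pose K : probability R R := kernel_probability kappa x.
have KS_eps t : `|fine (K (V x @^-1` `]-oo, t]%classic)) -
    fine (Q (W @^-1` `]-oo, t]%classic))| <= eps.
  apply: (@KS_score_le _ _ _ V x K (fun n => phi n x) (distribution Q W)) => //.
  by move=> s; rewrite measure_ge0 probability_le1.
have eps0 : 0 <= eps by exact: le_trans (KS_eps 0).
pose S i w := V (Xs i w) (Ys i w).
have mS i : measurable_fun setT (S i).
  exact: (measurableT_comp mV (measurable_fun_pair _ _)).
pose threshold n w := conformal_threshold alpha [seq S i w | i <- iota 0 n].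
have mthreshold n : measurable_fun setT (threshold n).
  exact: measurable_threshold.
pose r t := fine (Q (W @^-1` `]-oo, t[%classic)).
have rE t : Q (W @^-1` `]-oo, t[%classic) = (r t)%:E.
  by rewrite fineK// fin_num_measure//; exact: measurable_funPTI.
have [PZ ZZ] := iidXY.
have mW t : measurable (W @^-1` `]-oo, t[%classic) by exact: measurable_funPTI.
have PS t i : P (S i @^-1` `]-oo, t[%classic) = (r t)%:E.
  by rewrite -rE -(PZ i).
have PSS t i j : i != j ->
    P (S i @^-1` `]-oo, t[%classic `&` S j @^-1` `]-oo, t[%classic) =
    (r t * r t)%:E.
  move=> ij; rewrite EFinM -{1}(PS t i) -(PS t j).
  exact: (mutually_independent_pair ZZ (mW t) ij).
have coverageE n : conditional_coverage P Xs Ys kappa V alpha x n =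
    ((P \x K) [set wy | ((V x wy.2)%:E <= threshold n wy.1)%E])%E.
  rewrite /conditional_coverage; congr (product_measure1 _ _ _).
  by apply/seteqP; split=> -[w y] /=;
    rewrite /conformal_set/= /calibration_data -map_comp.
have mVxt t : measurable (V x @^-1` `]-oo, t]%classic).
  by rewrite -[X in measurable X]setTI; exact: mVx.
have KE t : K (V x @^-1` `]-oo, t]%classic) =
    (fine (K (V x @^-1` `]-oo, t]%classic)))%:E.
  by rewrite fineK// fin_num_measure.
have QE t : Q (W @^-1` `]-oo, t]%classic) =
    (fine (Q (W @^-1` `]-oo, t]%classic)))%:E.
  by rewrite fineK// fin_num_measure//; exact: measurable_funPTI.
split.
(* Half of [e] lowers the quantile level; the other half bounds the probability that the threshold
   misses [t]. *)
- apply: limn_einf_ge => e e0; pose p := 1 - alpha - e / 2.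
  have e2 : 0 < e / 2 by rewrite divr_gt0.
  (* No quantile is available at a level [p <= 0], but then the claimed lower bound is nonpositive
     since [eps >= 0]. *)
  have [p0|p0] := leP p 0.
    apply: nearW => n; rewrite coverageE; apply: (@le_trans _ _ 0%E) => //.
    by rewrite lee_fin; rewrite /p in p0; lra.
  have [|t /andP[tp pt]] := @exists_quantile _ _ _ Q W p.
    by rewrite p0/= /p; lra.
  have rt : r t + e / 2 <= 1 - alpha.
    by move: tp; rewrite rE lee_fin /p; lra.
  have := near_le_threshold mS (PS t) (PSS t) alpha_le1 e2 e2 rt.
  apply: filterS => n PA.
  rewrite coverageE; apply: le_trans (coverage_ge P K (mthreshold n) mVx t).
  pose h := fine (K (V x @^-1` `]-oo, t]%classic)).
  have h0 : 0 <= h by rewrite fine_ge0.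
  have h1 : h <= 1 by rewrite -lee_fin /h -KE probability_le1.
  have he : e / 2 * h <= e / 2 by rewrite ler_piMr// ltW.
  have := KS_eps t; rewrite -/h ler_norml => /andP[KS_ge _].
  move: pt; rewrite QE lee_fin /p => pt.
  (* As [h <= 1], the factor [1 - e / 2] costs at most [e / 2]. *)
  rewrite [X in (_ * X)%E]KE; apply: (@le_trans _ _ ((1 - e / 2) * h)%:E).
    by rewrite lee_fin; lra.
  by rewrite EFinM lee_wpmul2r.
- move=> Watomless; apply: limn_esup_le => e e0; pose p := 1 - alpha + e / 2.
  have e2 : 0 < e / 2 by rewrite divr_gt0.
  (* For [p >= 1] the claimed upper bound is at least 1. *)
  have [p1|p1] := leP 1 p.
    apply: nearW => n; rewrite coverageE.
    apply: le_trans (coverage_le1 P K (mthreshold n) mVx) _.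
    by rewrite lee_fin; rewrite /p in p1; lra.
  have [|t /andP[tp pt]] := @exists_quantile _ _ _ Q W p.
    by rewrite p1 andbT /p; lra.
  (* Without an atom at [t], both quantile inequalities become equalities: [r t] is large enough for
     concentration, while the CDF at [t] does not exceed [p]. *)
  have Q_itv : Q (W @^-1` `]-oo, t]%classic) = Q (W @^-1` `]-oo, t[%classic).
    have -> : `]-oo, t]%classic = `]-oo, t[%classic `|` [set t].
      by rewrite setUitv1.
    rewrite preimage_setU measureU//.
    - by rewrite -[RHS]adde0; congr (_ + _)%E; exact: Watomless.
    - apply/seteqP; split=> // z /=; rewrite in_itv/= => -[zt zE].
      by rewrite zE ltxx in zt.
  have rt : 1 - alpha <= r t - e / 2.
    by move: pt; rewrite Q_itv rE lee_fin /p; lra.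
  have := near_threshold_le mS (PS t) (PSS t) alpha_ge0 alpha_le1 e2 e2 rt.
  apply: filterS => n PA.
  rewrite coverageE; apply: le_trans (coverage_le P K (mthreshold n) mVx t) _.
  have := KS_eps t; rewrite ler_norml => /andP[_ KS_le].
  move: tp; rewrite -Q_itv QE lee_fin /p => tp.
  rewrite [X in (_ + X)%E]KE; apply: (le_trans (leeD PA (lexx _))).
  by rewrite -EFinD lee_fin; lra.
Qed.
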